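(* Let $D$ be a bounded convex domain in a Banach space $V$ and suppose that $(D,d)$ is a $(1,\kappa)$-quasi-geodesic metric space (for some $\kappa\ge0$), whose topology coincides with the norm topology, satisfying the condition $$d(sx+(1-s)y,z)\le\max\{d(x,z),d(y,z)\}\quad\text{for all }x,y,z\in D,\ s\in[0,1].$$ If $z_0\in D$, $r>0$ and $\xi\in\partial D$, then for every $\eta\in\overline{F_{z_0}(\xi,r)}^{\|\cdot\|}$ we have $$[\eta,\xi]\subset\overline{F_{z_0}(\xi,r)}^{\|\cdot\|}.$$
   Context: $\overline{A}^{\|\cdot\|}$ denotes closure in the norm topology, $\partial D=\overline{D}^{\|\cdot\|}\setminus D$, and $[\eta,\xi]$ is the closed line segment joining $\eta$ and $\xi$. $(D,d)$ is $(1,\kappa)$-quasi-geodesic if every pair of points of $D$ can be connected by a curve $\gamma:[a,b]\to D$ with $|t_1-t_2|-\kappa\le d(\gamma(t_1),\gamma(t_2))\le|t_1-t_2|+\kappa$ for all $t_1,t_2\in[a,b]$. Big horoball of center $\xi\in\partial D$, pole $z_0\in D$ and radius $r\in\mathbb{R}$: $F_{z_0}(\xi,r)=\{y\in D:\liminf_{w\to\xi}\,(d(y,w)-d(w,z_0))\le r\}$, where $w\in D$ tends to $\xi$ in norm. *)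

(* Defs.v *)
From HB Require Import structures.
From mathcomp Require Import all_boot all_order all_algebra.
From mathcomp Require Import all_classical all_reals all_analysis.
Set Implicit Arguments.
Unset Strict Implicit.
Unset Printing Implicit Defensive.
Import Order.TTheory GRing.Theory Num.Theory.
Import numFieldNormedType.Exports.
Local Open Scope classical_set_scope.
Local Open Scope ring_scope.

(* A metric space (D, d) carried by a subset D of V is given by a function d
   on the whole of V of which only the values on D are used. *)

Definition domain (T : topologicalType) (D : set T) : Prop :=
  [/\ open D, D !=set0 & connected D].

Definition metric_on (R : realType) (T : Type) (D : set T) (d : T -> T -> R)
    : Prop :=
  [/\ forall x y, D x -> D y -> 0 <= d x y,
      forall x y, D x -> D y -> (d x y = 0 <-> x = y),
      forall x y, D x -> D y -> d x y = d y x &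
      forall x y z, D x -> D y -> D z -> d x z <= d x y + d y z].

Definition metric_open (R : realType) (T : Type) (D : set T) (d : T -> T -> R)
    (U : set T) : Prop :=
  forall x, U x -> exists2 e : R, 0 < e & forall y, D y -> d x y < e -> U y.

(* d induces on D the subspace topology inherited from T. *)
Definition same_topology_on (R : realType) (T : topologicalType) (D : set T)
    (d : T -> T -> R) : Prop :=
  forall U : set T, U `<=` D ->
    (metric_open D d U <-> exists2 O : set T, open O & U = O `&` D).

(* Curves are continuous, here with respect to the metric d. *)
Definition curve_in (R : realType) (T : Type) (D : set T) (d : T -> T -> R)
    (a b : R) (gamma : R -> T) : Prop :=
  (forall t, t \in `[a, b] -> D (gamma t)) /\
  (forall t, t \in `[a, b] ->
     d (gamma t) (gamma s) @[s --> within `[a, b] (nbhs t)] --> 0).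

Definition quasi_geodesic_1 (R : realType) (T : Type) (D : set T)
    (d : T -> T -> R) (kappa : R) : Prop :=
  forall x y, D x -> D y ->
    exists a b : R, exists gamma : R -> T,
      [/\ a <= b, curve_in D d a b gamma, gamma a = x, gamma b = y &
          forall t1 t2, t1 \in `[a, b] -> t2 \in `[a, b] ->
            `|t1 - t2| - kappa <= d (gamma t1) (gamma t2)
              <= `|t1 - t2| + kappa].

Definition boundary_minus (T : topologicalType) (D : set T) : set T :=
  closure D `\` D.

Definition big_horoball (R : realType) (V : normedModType R) (D : set V)
    (d : V -> V -> R) (z0 xi : V) (r : R) : set V :=
  [set y | D y /\
     (limf_einf (fun w => (d y w - d w z0)%:E) (within D (nbhs xi))
        <= r%:E)%E].

Definition closed_segment (R : realType) (V : lmodType R) (x y : V) : set V :=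
  [set s *: x + (1 - s) *: y | s in `[0, 1]].

(* Main.v *)
(* For [y] in the horoball pick [w] near [xi] with [d y w - d w z0] almost at
   most [r].  The points [s y + (1 - s) w] and [s y + (1 - s) xi] are close for
   [d], and the former satisfies [d (s y + (1 - s) w) w <= d y w] because the
   maximum in the convexity condition is taken with [d w w = 0].  Hence, for
   [0 < s], the point [s y + (1 - s) xi] is in the horoball itself; the point
   [xi] and the case of [y] in the closure follow by continuity. *)
Require Import Defs.
From HB Require Import structures.
From mathcomp Require Import all_boot all_order all_algebra.
From mathcomp Require Import all_classical all_reals all_analysis.
Set Implicit Arguments.
Unset Strict Implicit.
Unset Printing Implicit Defensive.
Import Order.TTheory GRing.Theory Num.Theory.
Import numFieldNormedType.Exports.
Local Open Scope classical_set_scope.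
Local Open Scope ring_scope.

(** The lower limit is the supremum over [A] in [F] of the infima of [f] on [A]. Allowing an error
    [e] replaces each infimum, which need not be attained, by an actual point of [A]. *)
Lemma limf_einf_leP (T : choiceType) (X : filteredType T) (R : realType)
    (f : X -> R) (F : set (set X)) (r : R) :
  (limf_einf (fun w => (f w)%:E) F <= r%:E)%E <->
  forall e A, 0 < e -> F A -> exists2 w, A w & f w < r + e.
Proof.
rewrite limf_einfE; split=> [lef e A e0 FA|lef].
  have : (ereal_inf [set (f w)%:E | w in A] < (r + e)%:E)%E.
    apply: (@le_lt_trans _ _ r%:E); last by rewrite lte_fin ltrDl.
    by apply: le_trans lef; apply: ereal_sup_ubound; exists A.
  by move=> /ereal_inf_lt[_ [w Aw <-]]; rewrite lte_fin; exists w.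
apply: ge_ereal_sup => _ [A FA <-].
apply/lee_addgt0Pr => e e0; have [w Aw fw] := lef e A e0 FA.
apply: (@le_trans _ _ (f w)%:E); first by apply: ereal_inf_lbound; exists w.
by rewrite -EFinD lee_fin ltW.
Qed.

Lemma convex_set_conv (R : realType) (V : lmodType R) (D : set V) (x y : V)
    (s : R) :
  convex_set (D : set (convex_lmodType V)) -> D x -> D y -> 0 <= s <= 1 ->
  D (s *: x + (1 - s) *: y).
Proof.
move=> cD Dx Dy /andP[s0 s1].
exact: set_mem (cD x y (Itv01 s0 s1) (mem_set Dx) (mem_set Dy)).
Qed.

Lemma cvg_convr (R : realType) (V : normedModType R) (s : R) (y xi : V) :
  s *: y + (1 - s) *: w @[w --> xi] --> s *: y + (1 - s) *: xi.
Proof. by apply: cvgD; [exact: cvg_cst|by apply: cvgZl_tmp; exact: cvg_id]. Qed.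

(** Replacing [y] by a nearby [w] in [D] can be compensated by a small move of [x], which openness
    keeps inside [D]; plain convexity then applies. *)
Lemma open_convex_conv_closure (R : realType) (V : normedModType R) (D : set V)
    (x y : V) (s : R) :
  open D -> convex_set (D : set (convex_lmodType V)) ->
  D x -> closure D y -> 0 < s <= 1 -> D (s *: x + (1 - s) *: y).
Proof.
move=> oD cD Dx clDy /andP[s0 s1].
(* [g w] solves [s *: g w + (1 - s) *: w = s *: x + (1 - s) *: y]; the division by [s] is where
   [0 < s] enters. *)
pose g w := x + (s^-1 * (1 - s)) *: (y - w).
have gy : g w @[w --> y] --> x.
  rewrite -[X in _ --> X]addr0 -(scaler0 V (s^-1 * (1 - s))) -(subrr y).
  apply: cvgD; first exact: cvg_cst.
  by apply: cvgZl_tmp; apply: cvgB; [exact: cvg_cst|exact: cvg_id].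
have /gy Dg : nbhs x D by apply: open_nbhs_nbhs.
have [w [Dw Dgw]] := clDy _ Dg.
have -> : s *: x + (1 - s) *: y = s *: g w + (1 - s) *: w.
  rewrite /g scalerDr scalerA mulrA divff ?gt_eqF// mul1r scalerBr.
  by rewrite -addrA subrK.
by apply: convex_set_conv => //; rewrite ltW.
Qed.

(** By the triangle inequality the [d]-ball around [x] is [metric_open], hence the trace on [D] of
    an open set containing [x]. *)
Lemma same_topology_near (R : realType) (T : topologicalType) (D : set T)
    (d : T -> T -> R) (x : T) (e : R) :
  metric_on D d -> same_topology_on D d -> D x -> 0 < e ->
  \forall y \near x, D y -> d x y < e.
Proof.
move=> [_ d0 _ dtri] topd Dx e0.
have [|+ _] := topd [set y | D y /\ d x y < e]; first by move=> y [].
case=> [y [Dy xy]|O oO eqO].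
  exists (e - d x y); first by rewrite subr_gt0.
  move=> z Dz yz; split=> //; apply: le_lt_trans (dtri _ _ _ Dx Dy Dz) _.
  by rewrite -ltrBrDl.
have : O x.
  suff [] : (O `&` D) x by [].
  by rewrite -eqO; split=> //; rewrite (d0 _ _ Dx Dx).2.
move=> Ox; apply: filterS (open_nbhs_nbhs (conj oO Ox)) => y Oy Dy.
by have [] : [set y | D y /\ d x y < e] y by rewrite eqO.
Qed.

Lemma big_horoball_conv (R : realType) (V : normedModType R) (D : set V)
    (d : V -> V -> R) (z0 xi y : V) (r s : R) :
  open D -> convex_set (D : set (convex_lmodType V)) ->
  metric_on D d -> same_topology_on D d ->
  (forall x y z s, D x -> D y -> D z -> 0 <= s <= 1 ->
     d (s *: x + (1 - s) *: y) z <= Num.max (d x z) (d y z)) ->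
  closure D xi -> 0 < s <= 1 ->
  big_horoball D d z0 xi r y ->
  big_horoball D d z0 xi r (s *: y + (1 - s) *: xi).
Proof.
move=> oD cD metd topd dmax clxi s01 [Dy /limf_einf_leP lery].
have s01' : 0 <= s <= 1 by case/andP: s01 => /ltW -> ->.
have Dp : D (s *: y + (1 - s) *: xi) by exact: open_convex_conv_closure.
split=> //; apply/limf_einf_leP => e A e0 FA.
have e20 : 0 < e / 2 by rewrite divr_gt0.
(* Although [xi] may lie outside [D], the limit point [s *: y + (1 - s) *: xi] is in [D], so norm
   convergence to it yields closeness for [d]. *)
have near_p : \forall w \near xi, D (s *: y + (1 - s) *: w) ->
    d (s *: y + (1 - s) *: xi) (s *: y + (1 - s) *: w) < e / 2.
  exact: (cvg_convr (same_topology_near metd topd Dp e20)).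
(* Shrinking [A] first makes the [w] supplied by the lower limit at [y] satisfy the closeness
   estimate as well. *)
have FB : within D (nbhs xi) (A `&` [set w | D w /\
    d (s *: y + (1 - s) *: xi) (s *: y + (1 - s) *: w) < e / 2]).
  apply: filterI => //; apply: (filterS _ near_p) => w dw Dw.
  split=> //.
  by apply: dw; exact: convex_set_conv.
have [w [Aw [Dw dpw]] yw] := lery _ _ e20 FB.
exists w => //.
have [dge0 d0 _ dtri] := metd.
have Dq : D (s *: y + (1 - s) *: w) by exact: convex_set_conv.
have dqw : d (s *: y + (1 - s) *: w) w <= d y w.
  apply: le_trans (dmax _ _ _ _ Dy Dw Dw s01') _.
  by rewrite (d0 _ _ Dw Dw).2// ge_max lexx dge0.
rewrite ltrBlDr (le_lt_trans (dtri _ _ _ Dp Dq Dw))//.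
move: yw; rewrite ltrBlDr => yw.
(* One half of [e] pays for the passage between the two convex combinations, the other for the
   choice of [w]. *)
rewrite [e in r + e]splitr addrA addrAC [ltRHS]addrC ltrD//.
exact: le_lt_trans dqw yw.
Qed.

Theorem lemma4p3 (R : realType) (V : completeNormedModType R) (D : set V)
    (d : V -> V -> R) (kappa : R)
    (domD : domain D) (bndD : bounded_set D)
    (cvxD : convex_set (D : set (convex_lmodType V)))
    (metd : metric_on D d) (topd : same_topology_on D d)
    (kappa_ge0 : 0 <= kappa) (qgeo : quasi_geodesic_1 D d kappa)
    (d_max : forall x y z s, D x -> D y -> D z -> 0 <= s <= 1 ->
       d (s *: x + (1 - s) *: y) z <= Num.max (d x z) (d y z))
    (z0 xi : V) (r : R) (Dz0 : D z0) (r_gt0 : 0 < r)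
    (bdxi : boundary_minus D xi) (eta : V)
    (Feta : closure (big_horoball D d z0 xi r) eta) :
  closed_segment eta xi `<=` closure (big_horoball D d z0 xi r).

Proof.
have [oD _ _] := domD; have [clxi _] := bdxi.
have horo_conv s y : 0 < s <= 1 -> big_horoball D d z0 xi r y ->
    big_horoball D d z0 xi r (s *: y + (1 - s) *: xi).
  exact: big_horoball_conv.
move=> _ [s /= + <-]; rewrite in_itv/= le_eqVlt => /andP[/predU1P[<- _|s0 s1]] B.
  (* For [s = 0] the point is [xi] itself, reached as [t] decreases to [0] along the segment from
     any [y] in the horoball; [eta] serves only to show that such a [y] exists. *)
  rewrite scale0r add0r subr0 scale1r => nB.
  have [y [Fy _]] := Feta setT filterT.
  have : (t *: y + (1 - t) *: xi) @[t --> (0 : R)^'+] --> xi.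
    rewrite -[X in _ --> X]add0r -[X in _ --> X + _](scale0r y).
    rewrite -[X in _ --> _ + X]scale1r -[X in _ --> _ + X *: _]subr0.
    apply: cvg_at_right_filter; apply: cvgD; first by apply: cvgZr_tmp; exact: cvg_id.
    by apply: cvgZr_tmp; apply: cvgB; [exact: cvg_cst|exact: cvg_id].
  move=> /(_ _ nB) nearB; near (0 : R)^'+ => t.
  exists (t *: y + (1 - t) *: xi); split; last by near: t.
  apply: horo_conv => //; apply/andP; split; near: t.
    exact: nbhs_right_gt.
  exact: nbhs_right_le.
move=> nB.
(* For [0 < s] the map with this limit is continuous and sends the horoball into itself, hence its
   closure into its closure. *)
have /(_ _ nB) nearB : s *: y + (1 - s) *: xi @[y --> eta] -->
    s *: eta + (1 - s) *: xi.
  by apply: cvgD; [by apply: cvgZl_tmp; exact: cvg_id|exact: cvg_cst].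
have [y [Fy By]] := Feta _ nearB.
by exists (s *: y + (1 - s) *: xi); split=> //; apply: horo_conv => //; rewrite s0.
Unshelve. all: by end_near. Qed.
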